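(* Let $V=\{p_0,\ldots,p_n\}$. For every BDD $\Omega$ over $V\cup V'$ and all $s,t\subseteq V$: $s\xrightarrow{\tau_0(\Omega)}t$ if and only if $s\cup t'\vDash\Omega$.
   Context: $V=\{p_0,\ldots,p_n\}$ is ordered $p_0<\dots<p_n$; $V'=\{p_0',\ldots,p_n'\}$ is a fresh copy and $t'=\{p'\mid p\in t\}$. BDDs over $V\cup V'$ are reduced ordered binary decision diagrams w.r.t. $p_0<p_0'<p_1<p_1'<\dots<p_n<p_n'$, representing Boolean functions on subsets of $V\cup V'$; leaves are $\top,\bot$; $(t_0\dashleftarrow(q)\rightarrow t_1)$ is an inner node labelled $q$ with else-child $t_0$ and then-child $t_1$. Mental programs over $V$: $\pi::=p\leftarrow\top\mid p\leftarrow\bot\mid\beta?\mid\pi\cup\pi\mid\pi;\pi\mid\pi\cap\pi$; for $s,t\subseteq V$: $s\xrightarrow{p\leftarrow\top}t$ iff $t=s\cup\{p\}$; $s\xrightarrow{p\leftarrow\bot}t$ iff $t=s\setminus\{p\}$; $s\xrightarrow{\beta?}t$ iff $s=t$ and $s\vDash\beta$; $\cup,\cap$ union/intersection of relations; $;$ relational composition ($s\xrightarrow{\pi_1;\pi_2}t$ iff some $u\subseteq V$ has $s\xrightarrow{\pi_1}u\xrightarrow{\pi_2}t$). The function $\tau$: $\tau(\bot,L)=?\bot$; $\tau(\top,[])=?\top$; $\tau(\top,[p_k,\ldots,p_n])=((p_k\leftarrow\bot)\cup(p_k\leftarrow\top));\tau(\top,[p_{k+1},\ldots,p_n])$; for $\Omega=(t_0\dashleftarrow(p_i)\rightarrow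 t_1)$: $\tau(\Omega,[p_k,\ldots,p_n])=(?\neg p_k;\tau(t_0,[p_k,\ldots,p_n]))\cup(?p_k;\tau(t_1,[p_k,\ldots,p_n]))$ if $i=k$, and $((p_k\leftarrow\bot)\cup(p_k\leftarrow\top));\tau(\Omega,[p_{k+1},\ldots,p_n])$ otherwise; for $\Omega=(t_0\dashleftarrow(p_i')\rightarrow t_1)$: $\tau(\Omega,[p_k,\ldots,p_n])=(p_k\leftarrow\bot;\tau(t_0,[p_{k+1},\ldots,p_n]))\cup(p_k\leftarrow\top;\tau(t_1,[p_{k+1},\ldots,p_n]))$ if $i=k$, and $((p_k\leftarrow\bot)\cup(p_k\leftarrow\top));\tau(\Omega,[p_{k+1},\ldots,p_n])$ otherwise. Finally $\tau_0(\Omega):=\tau(\Omega,[p_0,\ldots,p_n])$. *)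

(* Defs.v *)
From mathcomp Require Import all_boot.

Set Implicit Arguments.
Unset Strict Implicit.
Unset Printing Implicit Defensive.

(* The atom p_i is the ordinal i : 'I_n.+1, so V = 'I_n.+1; states are s : {set 'I_n.+1}. *)

Inductive formula (n : nat) : Type :=
| FTop
| FBot
| FVar of 'I_n.+1
| FNeg of formula n
| FAnd of formula n & formula n.
Arguments FTop {n}.
Arguments FBot {n}.

Fixpoint fsat (n : nat) (s : {set 'I_n.+1}) (b : formula n) : bool :=
  match b with
  | FTop => true
  | FBot => false
  | FVar p => p \in s
  | FNeg b1 => ~~ fsat s b1
  | FAnd b1 b2 => fsat s b1 && fsat s b2
  end.

Inductive program (n : nat) : Type :=
| SetTop of 'I_n.+1
| SetBot of 'I_n.+1
| Test of formula n
| Cup of program n & program n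
| Seq of program n & program n
| Cap of program n & program n.

Fixpoint step (n : nat) (pi : program n) (s t : {set 'I_n.+1}) : Prop :=
  match pi with
  | SetTop p => t = s :|: [set p]
  | SetBot p => t = s :\: [set p]
  | Test b => s = t /\ fsat s b
  | Cup pi1 pi2 => step pi1 s t \/ step pi2 s t
  | Seq pi1 pi2 => exists u : {set 'I_n.+1}, step pi1 s u /\ step pi2 u t
  | Cap pi1 pi2 => step pi1 s t /\ step pi2 s t
  end.

(* The disjoint union of V and V': inl i is p_i and inr i is p_i'. *)
Notation dvar n := ('I_n.+1 + 'I_n.+1)%type.

(* Position in p_0 < p_0' < p_1 < p_1' < ... < p_n < p_n'. *)
Definition rank (n : nat) (q : dvar n) : nat :=
  match q with
  | inl i => i.*2
  | inr i => i.*2.+1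
  end.

(* Decision diagrams as terms: Node q t0 t1 has else-child t0 and then-child t1.
   Isomorphic sub-diagrams are equal terms, so the sharing of nodes is implicit
   and "t0 and t1 are the same node" is the equation t0 = t1. *)
Inductive diagram (n : nat) : Type :=
| Leaf of bool
| Node of dvar n & diagram n & diagram n.
Arguments Leaf {n}.

Definition below_root (n : nat) (q : dvar n) (W : diagram n) : bool :=
  match W with
  | Leaf _ => true
  | Node r _ _ => rank q < rank r
  end.

Fixpoint ordered (n : nat) (W : diagram n) : Prop :=
  match W with
  | Leaf _ => True
  | Node q t0 t1 =>
      [/\ below_root q t0, below_root q t1, ordered t0 & ordered t1]
  end.

Fixpoint reduced (n : nat) (W : diagram n) : Prop :=
  match W with
  | Leaf _ => True
  | Node _ t0 t1 => [/\ t0 <> t1, reduced t0 & reduced t1]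
  end.

Definition is_bdd (n : nat) (W : diagram n) : Prop := ordered W /\ reduced W.

Fixpoint dsat (n : nat) (a : {set dvar n}) (W : diagram n) : bool :=
  match W with
  | Leaf b => b
  | Node q t0 t1 => if q \in a then dsat a t1 else dsat a t0
  end.

Definition unprimed (n : nat) (s : {set 'I_n.+1}) : {set dvar n} :=
  [set (inl p : dvar n) | p in s].
Definition primed (n : nat) (t : {set 'I_n.+1}) : {set dvar n} :=
  [set (inr p : dvar n) | p in t].

Definition havoc (n : nat) (p : 'I_n.+1) : program n := Cup (SetBot p) (SetTop p).

(* The inner-node clauses on [::] are never reached from tau0 on an ordered
   diagram; the value there is arbitrary. *)
Fixpoint tau (n : nat) (W : diagram n) : seq 'I_n.+1 -> program n :=
  match W with
  | Leaf false => fun _ => Test FBot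
  | Leaf true =>
      fix tauW (L : seq 'I_n.+1) : program n :=
        match L with
        | [::] => Test FTop
        | p :: L' => Seq (havoc p) (tauW L')
        end
  | Node (inl i) t0 t1 =>
      fix tauW (L : seq 'I_n.+1) : program n :=
        match L with
        | [::] => Test FBot
        | p :: L' =>
            if i == p then
              Cup (Seq (Test (FNeg (FVar p))) (tau t0 (p :: L')))
                  (Seq (Test (FVar p)) (tau t1 (p :: L')))
            else Seq (havoc p) (tauW L')
        end
  | Node (inr i) t0 t1 =>
      fix tauW (L : seq 'I_n.+1) : program n :=
        match L with
        | [::] => Test FBot
        | p :: L' =>
            if i == p then
              Cup (Seq (SetBot p) (tau t0 L')) (Seq (SetTop p) (tau t1 L'))
            else Seq (havoc p) (tauW L')
        end
  end.

(* enum 'I_n.+1 is the increasing list [p_0, ..., p_n]. *)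
Definition tau0 (n : nat) (W : diagram n) : program n := tau W (enum 'I_n.+1).

(* Main.v *)
(** The programs built by [tau] on the list [p_k, ..., p_n] only write to those
    atoms, so they relate [s] to [t] exactly when [s] and [t] agree on
    [p_0, ..., p_(k-1)] and [s :|: t'] satisfies the diagram.  Diagrams whose
    root has rank at least [2 k] do not read earlier variables; hence once [p_k]
    has been written, its old value is irrelevant to the rest of the run. *)
Require Import Defs.
From mathcomp Require Import all_boot.

Set Implicit Arguments.
Unset Strict Implicit.
Unset Printing Implicit Defensive.

(** One numeric bound serves both kinds of variable: [k.*2] admits [p_k] and all later variables,
    while [(rank q).+1] recovers the strict order of [below_root]. *)
Definition root_ge (n m : nat) (W : diagram n) : bool :=
  if W is Node q _ _ then m <= rank q else true.

Definition agree_below (n k : nat) (s t : {set 'I_n.+1}) : Prop :=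
  forall i : 'I_n.+1, i < k -> (i \in s) = (i \in t).

Definition assign (n : nat) (b : bool) (p : 'I_n.+1) : program n :=
  if b then SetTop p else SetBot p.

Definition update (n : nat) (b : bool) (p : 'I_n.+1) (s : {set 'I_n.+1}) :=
  if b then s :|: [set p] else s :\: [set p].

Lemma below_root_ge (n : nat) (q : dvar n) (W : diagram n) :
  below_root q W = root_ge (rank q).+1 W.
Proof. by case: W. Qed.

Lemma root_ge_leq (n m m' : nat) (W : diagram n) :
  m <= m' -> root_ge m' W -> root_ge m W.
Proof. by case: W => //= q _ _; apply: leq_trans. Qed.

Lemma in_unprimed_primed (n : nat) (s t : {set 'I_n.+1}) (q : dvar n) :
  (q \in unprimed s :|: primed t) =
  match q with inl i => i \in s | inr i => i \in t end.
Proof.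
have inlI : injective (@inl 'I_n.+1 'I_n.+1) by move=> x y [].
have inrI : injective (@inr 'I_n.+1 'I_n.+1) by move=> x y [].
rewrite inE; case: q => i.
- by rewrite (mem_imset _ _ inlI) orbC; case: imsetP => [[]|].
- by rewrite (mem_imset _ _ inrI); case: imsetP => [[]|].
Qed.

(** Ranks increase along every path of an ordered diagram, so evaluation never queries a variable
    ranked before the root. *)
Lemma eq_dsat_ge (n m : nat) (a b : {set dvar n}) (W : diagram n) :
  ordered W -> root_ge m W ->
  (forall q, m <= rank q -> (q \in a) = (q \in b)) -> dsat a W = dsat b W.
Proof.
elim: W m => //= q t0 IH0 t1 IH1 m []; rewrite !below_root_ge => h0 h1 o0 o1 mq eab.
have eab' r : (rank q).+1 <= rank r -> (r \in a) = (r \in b).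
  by move=> qr; apply/eab/(leq_trans mq)/ltnW.
by rewrite eab // (IH0 _ o0 h0 eab') (IH1 _ o1 h1 eab').
Qed.

Lemma in_update (n : nat) (b : bool) (p : 'I_n.+1) (s : {set 'I_n.+1}) (i : 'I_n.+1) :
  (i \in update b p s) = if i == p then b else i \in s.
Proof. by case: b; rewrite !inE; case: (i == p); rewrite ?orbT ?orbF. Qed.

Lemma step_assign (n : nat) (b : bool) (p : 'I_n.+1) (s t : {set 'I_n.+1}) :
  step (assign b p) s t <-> t = update b p s.
Proof. by case: b. Qed.

Lemma dsat_update (n : nat) (b : bool) (p : 'I_n.+1) (s t : {set 'I_n.+1})
    (W : diagram n) :
  ordered W -> root_ge p.+1.*2 W ->
  dsat (unprimed (update b p s) :|: primed t) W = dsat (unprimed s :|: primed t) W.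
Proof.
move=> oW gW; apply: (eq_dsat_ge oW gW) => -[i|i] /=; rewrite !in_unprimed_primed //.
by rewrite leq_double in_update; case: eqP => // ->; rewrite ltnn.
Qed.

Lemma agree_below_update (n : nat) (b : bool) (p : 'I_n.+1) (s t : {set 'I_n.+1}) :
  agree_below p.+1 (update b p s) t <-> agree_below p s t /\ (p \in t) = b.
Proof.
split=> [h|[h tp] i].
- split=> [i ip|]; last by rewrite -h // in_update eqxx.
  by rewrite -h ?in_update ?ltnS 1?ltnW //; case: eqP ip => // ->; rewrite ltnn.
- rewrite in_update ltnS leq_eqVlt; case: (eqVneq i p) => [-> //|ne].
  by rewrite val_eqE (negPf ne); apply: h.
Qed.

Definition realizes (n k : nat) (P : program n) (W : diagram n) : Prop :=
  forall s t, step P s t <->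
    agree_below k s t /\ dsat (unprimed s :|: primed t) W.

Section Assignments.
Variables (n : nat) (p : 'I_n.+1) (P : program n) (W : diagram n).
Hypotheses (oW : ordered W) (gW : root_ge p.+1.*2 W) (hP : realizes p.+1 P W).

(** [P] leaves [p] alone, so its final value is the assigned one; [W] does not read the unprimed
    [p], so the updated state and [s] give the same verdict. *)
Lemma step_assign_seq (b : bool) (s t : {set 'I_n.+1}) :
  step (Seq (assign b p) P) s t <->
  [/\ agree_below p s t, (p \in t) = b & dsat (unprimed s :|: primed t) W].
Proof.
split=> /= [[u [/step_assign-> /hP[/agree_below_update[? ?]]]]|[? ? dW]].
- by rewrite dsat_update.
- exists (update b p s); split; first exact/step_assign.
  by apply/hP; rewrite dsat_update //; split=> //; apply/agree_below_update.
Qed.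

Lemma realizes_havoc : realizes p (Seq (havoc p) P) W.
Proof.
move=> s t; split=> [[u [[su|su] Pu]]|[st dW]].
- by have /step_assign_seq[] : step (Seq (assign false p) P) s t by exists u.
- by have /step_assign_seq[] : step (Seq (assign true p) P) s t by exists u.
(* The branch of [havoc] to take is dictated by whether [t] contains [p]. *)
- have /step_assign_seq[u [su Pu]] := And3 st (erefl (p \in t)) dW.
  by exists u; split=> //; move: su; rewrite /assign; case: (p \in t); [right|left].
Qed.

End Assignments.

Lemma drop_enum_ord (n : nat) (p : 'I_n.+1) :
  drop p (enum 'I_n.+1) = p :: drop p.+1 (enum 'I_n.+1).
Proof. by rewrite (drop_nth p) ?size_enum_ord // nth_ord_enum. Qed.

(** Downward induction, since [tau] consumes the list from the front: the empty suffix is the base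
    case. *)
Lemma drop_enum_ind (n : nat) (Q : nat -> Prop) :
  Q n.+1 -> (forall p : 'I_n.+1, Q p.+1 -> Q p) -> forall k, k <= n.+1 -> Q k.
Proof.
move=> Qn QS k kn; rewrite -(subKn kn); elim: (n.+1 - k) (leq_subr k n.+1) => [|m IH] mn.
  by rewrite subn0.
have lt : n.+1 - m.+1 < n.+1 by rewrite ltn_subrL.
by apply: (QS (Ordinal lt)); rewrite /= subnSK //; apply/IH/ltnW.
Qed.

(** The nested fixpoints of [tau] dictate the inductions: structural on [W] outside, downward on [k]
    inside. *)
Lemma realizes_tau (n : nat) (W : diagram n) : ordered W ->
  forall k, k <= n.+1 -> root_ge k.*2 W ->
  realizes k (tau W (drop k (enum 'I_n.+1))) W.
Proof.
elim: W => [[]|[i|i] t0 IH0 t1 IH1] oW.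
- apply: drop_enum_ind => [_ s t|p IH _].
    rewrite drop_oversize ?size_enum_ord //=; split=> [[-> _]|[st _]] //.
    (* Agreement below [n.+1] covers every atom. *)
    by split=> //; apply/setP=> i; apply/st/ltn_ord.
  by rewrite drop_enum_ord; apply: realizes_havoc => //; apply: IH.
- by move=> k _ _ s t /=; split=> -[].
- have [] := oW; rewrite !below_root_ge /= => g0 g1 o0 o1.
  apply: drop_enum_ind => [|p IH gW].
    (* No root has rank [n.+1.*2] or more, so the arbitrary value on the empty list is never met. *)
    by rewrite /= leq_double leqNgt ltn_ord.
  rewrite drop_enum_ord /=; case: eqP => [ip|/eqP ip].
    subst i; rewrite -drop_enum_ord => s t /=; rewrite in_unprimed_primed.
    (* The test keeps [p] on the list, so the children are taken at the same [k = p]. *)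
    have {}IH0 := IH0 o0 p (ltnW (ltn_ord p)) (root_ge_leq (leqnSn _) g0).
    have {}IH1 := IH1 o1 p (ltnW (ltn_ord p)) (root_ge_leq (leqnSn _) g1).
    split=> [[][u [[<- sp]]]|[st]].
    + by move=> /IH0; rewrite (negPf sp).
    + by move=> /IH1; rewrite sp.
    + case: ifPn => sp dW; [right|left]; exists s; split=> //.
      * exact/IH1.
      * exact/IH0.
  (* The root index is at least [p] and differs from it, so the bound moves on to [p.+1]. *)
  have gW' : root_ge p.+1.*2 (Node (inl i) t0 t1).
    by move: gW; rewrite /= !leq_double ltn_neqAle eq_sym => ->; rewrite andbT.
  by apply: realizes_havoc => //; apply: IH.
- have [] := oW; rewrite !below_root_ge /= => g0 g1 o0 o1.
  apply: drop_enum_ind => [|p IH gW].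
    by rewrite /= leq_Sdouble leqNgt ltn_ord.
  rewrite drop_enum_ord /=; case: eqP => [ip|/eqP ip].
    subst i => s t.
    (* The rank following that of [inr p] is [p.*2.+2], which is [p.+1.*2] by computation, so [g0]
       and [g1] fit the shortened list. *)
    have S0 := step_assign_seq o0 g0 (IH0 o0 p.+1 (ltn_ord p) g0) false s t.
    have S1 := step_assign_seq o1 g1 (IH1 o1 p.+1 (ltn_ord p) g1) true s t.
    rewrite [dsat _ _]/= in_unprimed_primed; split=> [[/S0|/S1] [? ->]|[st]] //.
    by case: ifP => tp dW; [right; apply/S1|left; apply/S0].
  have gW' : root_ge p.+1.*2 (Node (inr i) t0 t1).
    by move: gW; rewrite /= !leq_Sdouble ltn_neqAle eq_sym => ->; rewrite andbT.
  by apply: realizes_havoc => //; apply: IH.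
Qed.

Theorem theorem15 (n : nat) (W : diagram n) (hW : is_bdd W)
    (s t : {set 'I_n.+1}) :
  step (tau0 W) s t <-> dsat (unprimed s :|: primed t) W.
Proof.
have g0 : root_ge 0.*2 W by case: W {hW}.
have := realizes_tau hW.1 (leq0n _) g0 s t.
by rewrite drop0 => -[h1 h2]; split=> [/h1[]|dW] //; apply: h2.
Qed.
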